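(* If $N_1\leftrightarrow_{sp}N_2$ for nets $N_1$ and $N_2$, then $N_1\equiv_{caus}N_2$.
   Context: Petri nets: $N=(S,T,F,M_0,A,\ell)$ with disjoint sets $S$ (places), $T$ (transitions), $F:(S\times T)\cup(T\times S)\to\mathbb N$, initial marking $M_0\in\mathbb N^S$, type $A$, labelling $\ell:T\to A$; ${}^\bullet x(y)=F(y,x)$, $x^\bullet(y)=F(x,y)$; $t$ enabled at $M$ iff ${}^\bullet t\le M$, firing yields $M-{}^\bullet t+t^\bullet$; reachable markings arise from $M_0$ by finite firing sequences. A net is a Petri net with bounded parallelism (no reachable $M$ and multiset $U$ of transitions with infinitely many elements with $\sum_{t\in U}{}^\bullet t\le M$). sp-bisimilarity: for nets $N_i=(S_i,T_i,F_i,M_i,A_i,\ell_i)$, a linking is $l\in\mathbb N^{S_1\times S_2}$ with $\pi_1(l)(s_1)=\sum_{s_2}l(s_1,s_2)$, $\pi_2(l)(s_2)=\sum_{s_1}l(s_1,s_2)$. An sp-bisimulation is a set $\mathcal B$ of linkings such that whenever $c\le l\in\mathcal B$ and $\pi_1(c)={}^\bullet t_1$ ($t_1\in T_1$) there are $t_2\in T_2$ with $\ell_2(t_2)=\ell_1(t_1)$, $\pi_2(c)={}^\bullet t_2$ and a linking $\bar c$ with $\pi_1(\bar c)=t_1^\bullet$, $\pi_2(\bar c)=t_2^\bullet$, $l-c+\bar c\in\mathcal B$, and symmetrically with $N_1,N_2$ exchanged. $N_1\leftrightarrow_{sp}N_2$ iff $A_1=A_2$ and some sp-bisimulation contains $l$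 with $\pi_i(l)=M_i$ ($i=1,2$). A causal net is a net $\mathcal N=(\mathcal S,\mathcal T,\mathcal F,\mathcal M_0,\mathcal A,\ell_{\mathcal N})$ in which every place has at most one pre-transition and at most one post-transition, $\mathcal M_0(s)=1$ iff $s$ has no pre-transition (else 0), the transitive closure $\mathcal F^+$ of the flow is irreflexive, and every transition has finitely many $\mathcal F^+$-predecessor transitions. A folding of $\mathcal N$ into $N$ is a map $\rho$ sending places to places and transitions to transitions, with $\mathcal A=A$, $\ell_{\mathcal N}(t)=\ell(\rho(t))$, $\rho(\mathcal M_0)=M_0$, $\rho({}^\bullet t)={}^\bullet\rho(t)$ and $\rho(t^\bullet)=\rho(t)^\bullet$ for all transitions $t$, where $\rho(H)(s)=|\rho^{-1}(s)\cap H|$. A process of $N$ is a pair $(\mathcal N,\rho)$ of a causal net and a folding of it into $N$. A causal net of $N$ is the first component of some process of $N$. $N_1\equiv_{caus}N_2$ (causal equivalence) iff $N_1$ and $N_2$ have the same causal nets. *)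

(* Defs.v *)
From Stdlib Require Import Relation_Operators.
From mathcomp Require Import all_boot.
From mathcomp Require Import all_classical.

Set Implicit Arguments.
Unset Strict Implicit.
Unset Printing Implicit Defensive.

Local Open Scope nat_scope.
Local Open Scope classical_set_scope.

Definition multiset (X : Type) : Type := X -> nat.

Definition elements (X : Type) (A : multiset X) : set X := [set x | 0 < A x].

Definition msub (X : Type) (A B : multiset X) : Prop := forall x, A x <= B x.

(* The sum of the A x over x in D converges in nat and equals n.  The finiteness
   clause is needed because \big_(x \in D) is 0 on families of infinite support. *)
Definition sums_to (X : Type) (D : set X) (A : multiset X) (n : nat) : Prop :=
  finite_set (D `&` elements A) /\
  \big[addn/0]_(x \in (D : set {classic X})) A x = n.

(* mimage f H K : the image multiset f(H) exists and equals K; for a plain set H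
   (multiplicities at most 1) this says K y = #|f^-1(y) `&` H|. *)
Definition mimage (X Y : Type) (f : X -> Y) (H : multiset X) (K : multiset Y) :
    Prop :=
  forall y, sums_to (f @^-1` [set y]) H (K y).

(* Labels are drawn from an ambient type Act, and the type A of a net is a
   subset of Act, so that equality of the types of two nets makes sense. *)
Record petri_net (Act : Type) : Type := PetriNet {
  place : Type;
  transition : Type;
  flow_pt : place -> transition -> nat;
  flow_tp : transition -> place -> nat;
  init : multiset place;
  type_of_net : set Act;
  label : transition -> Act;
  label_in_type : forall t, type_of_net (label t) }.

Arguments init {Act} p _.

Section Nets.
Variables (Act : Type) (N : petri_net Act).

Definition pre (t : transition N) : multiset (place N) :=
  fun s => flow_pt s t.
Definition post (t : transition N) : multiset (place N) :=
  fun s => flow_tp t s.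
Definition pre_place (s : place N) : multiset (transition N) :=
  fun t => flow_tp t s.
Definition post_place (s : place N) : multiset (transition N) :=
  fun t => flow_pt s t.

Definition enabled (M : multiset (place N)) (t : transition N) : Prop :=
  msub (pre t) M.

Definition fire (M : multiset (place N)) (t : transition N) :
    multiset (place N) :=
  fun s => M s - pre t s + post t s.

Inductive reachable : multiset (place N) -> Prop :=
| reachable_init : reachable (init N)
| reachable_fire M t : reachable M -> enabled M t -> reachable (fire M t).

Definition bounded_parallelism : Prop :=
  ~ exists M (U : multiset (transition N)),
      [/\ reachable M,
          infinite_set (elements U) &
          forall s, exists2 n,
            sums_to [set: transition N] (fun t => U t * pre t s) n & n <= M s].

Definition is_net : Prop := bounded_parallelism.

Definition flow_arc (x y : place N + transition N) : Prop :=
  match x, y with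
  | inl s, inr t => 0 < flow_pt s t
  | inr t, inl s => 0 < flow_tp t s
  | _, _ => False
  end.

Definition flow_plus : place N + transition N -> place N + transition N -> Prop :=
  clos_trans _ flow_arc.

(* Pre- and post-transitions of a place are counted as multisets, i.e. with
   their arc weights, so all arcs of a causal net have weight at most 1. *)
Definition causal_net : Prop :=
  [/\ is_net,
      forall s,
        (exists2 n, sums_to setT (pre_place s) n & n <= 1) /\
        (exists2 n, sums_to setT (post_place s) n & n <= 1),
      forall s,
        init N s = if `[< exists t, 0 < pre_place s t >] then 0 else 1,
      forall x, ~ flow_plus x x &
      forall t, finite_set [set u : transition N | flow_plus (inr u) (inr t)]].

End Nets.

Section Linkings.
Variables (Act : Type) (N1 N2 : petri_net Act).

Definition linking : Type := multiset (place N1 * place N2).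

(* proj_i l M : the i-th projection of l is defined (its sums are finite) and
   equals M. *)
Definition proj1_link (l : linking) (M : multiset (place N1)) : Prop :=
  forall s1, sums_to [set: place N2] (fun s2 => l (s1, s2)) (M s1).
Definition proj2_link (l : linking) (M : multiset (place N2)) : Prop :=
  forall s2, sums_to [set: place N1] (fun s1 => l (s1, s2)) (M s2).

Definition replace_link (l c c' : linking) : linking :=
  fun p => l p - c p + c' p.

Definition sp_bisimulation (B : set linking) : Prop :=
  forall l c, B l -> msub c l ->
    (forall t1 : transition N1, proj1_link c (pre t1) ->
       exists (t2 : transition N2) (c' : linking),
         [/\ label t2 = label t1, proj2_link c (pre t2),
             proj1_link c' (post t1), proj2_link c' (post t2) &
             B (replace_link l c c')]) /\
    (forall t2 : transition N2, proj2_link c (pre t2) ->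
       exists (t1 : transition N1) (c' : linking),
         [/\ label t1 = label t2, proj1_link c (pre t1),
             proj1_link c' (post t1), proj2_link c' (post t2) &
             B (replace_link l c c')]).

Definition sp_bisimilar : Prop :=
  type_of_net N1 = type_of_net N2 /\
  exists B : set linking, sp_bisimulation B /\
    exists l : linking,
      [/\ B l, proj1_link l (init N1) & proj2_link l (init N2)].

End Linkings.

(* The map rho from places to places and transitions to transitions is given by
   its two components rhoS and rhoT. *)
Definition folding (Act : Type) (C N : petri_net Act)
    (rhoS : place C -> place N) (rhoT : transition C -> transition N) : Prop :=
  [/\ type_of_net C = type_of_net N,
      forall t, label t = label (rhoT t),
      mimage rhoS (init C) (init N),
      forall t, mimage rhoS (pre t) (pre (rhoT t)) &
      forall t, mimage rhoS (post t) (post (rhoT t))].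

Definition process (Act : Type) (N C : petri_net Act)
    (rhoS : place C -> place N) (rhoT : transition C -> transition N) : Prop :=
  causal_net C /\ folding rhoS rhoT.

Definition causal_net_of (Act : Type) (N C : petri_net Act) : Prop :=
  exists (rhoS : place C -> place N) (rhoT : transition C -> transition N),
    process rhoS rhoT.

Definition causal_equivalent (Act : Type) (N1 N2 : petri_net Act) : Prop :=
  forall C : petri_net Act, causal_net_of N1 C <-> causal_net_of N2 C.

(* Main.v *)
(* Let l be a linking in a bisimulation B and suppose that the current cut of a
   causal net C is mapped place by place to pairs (s1, s2), each pair being hit
   l(s1, s2) times.  When a transition t of C is enabled at the cut, its preset
   determines a sublinking c of l; the transfer property answers with a
   transition of N2 and a linking c' whose first projection is the image of the
   postset of t, and distributing the pairs of c' over this postset continues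
   the folding into N2.  The transitions of C can be fired in an omega-sequence
   although markings may be infinite: by bounded parallelism only finitely many
   transitions are enabled at a cut, and firing all of them stage by stage
   exhausts C because every transition has finitely many predecessors. *)
Require Import Defs.
From Stdlib Require Import Relation_Operators.
From mathcomp Require Import all_boot.
From mathcomp Require Import finmap all_classical.

Set Implicit Arguments.
Unset Strict Implicit.
Unset Printing Implicit Defensive.

Local Open Scope card_scope.
Local Open Scope nat_scope.
Local Open Scope classical_set_scope.

(** * Finite sums over multisets *)

Section Sums.
Variable X : Type.
Implicit Types (D : set X) (A B : multiset X).

(* Multisets turned into plain sets: sums become cardinalities, and a sum over a
   family of fibres is computed by gluing bijections. *)
Definition instances D A : set (X * nat) := [set p | D p.1 /\ p.2 < A p.1].

Lemma finite_uniq_seq D : finite_set D ->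
  exists2 r : seq {classic X}, uniq r & D = [set` r].
Proof.
move=> /(@finite_seqP {classic X})[r Dr].
exists (undup r); first exact: undup_uniq.
by rewrite Dr; apply/seteqP; split=> x /=; rewrite mem_undup.
Qed.

(** Any duplicate-free list covering the support in [D] will do, so that one list can serve for two
    multisets at once. *)
Lemma sums_to_seq D A (r : seq {classic X}) n : uniq r ->
  D `&` elements A `<=` [set` r] ->
  sums_to D A n <-> \sum_(x <- r | x \in (D : set {classic X})) A x = n.
Proof.
move=> ur Dr; have fD : finite_set (D `&` elements A).
  exact: (@sub_finite_set X _ _ Dr (@finite_seq {classic X} r)).
suff <- : \big[addn/0]_(x \in (D : set {classic X})) A x =
    \sum_(x <- r | x \in (D : set {classic X})) A x by split=> [[]|].
rewrite [RHS]bigfs //; first by rewrite set_mem_set.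
move=> x; rewrite inE => Dx xr; apply/eqP; rewrite -leqn0 leqNgt.
by apply/negP => Ax; move/negP: xr; apply; apply: Dr.
Qed.

Lemma sums_to_inj D A m n : sums_to D A m -> sums_to D A n -> m = n.
Proof. by move=> [_ <-] [_ <-]. Qed.

Lemma instances_seq (r : seq {classic X}) A : uniq r ->
  [set p : X * nat | p.1 \in r /\ p.2 < A p.1] #= `I_(\sum_(x <- r) A x).
Proof.
move=> ur.
pose s : seq ({classic X} * nat) := [seq (x, i) | x <- r, i <- iota 0 (A x)].
have us : uniq s.
  apply: (@allpairs_uniq_dep {classic X} (fun=> nat) ({classic X} * nat)%type pair
    r (fun x => iota 0 (A x))) => // [x _|]; first exact: iota_uniq.
  by move=> [x i] [y j] _ _ /= [-> ->].
have ms x i : ((x, i) \in s) = (x \in r) && (i < A x).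
  apply/(@allpairsPdep {classic X} (fun=> nat) _ pair)/andP.
    by move=> [y [j [yr]]]; rewrite mem_iota => /= jA [-> ->].
  by move=> [xr iA]; exists x, i; rewrite mem_iota.
have -> : [set p : X * nat | p.1 \in r /\ p.2 < A p.1] = [set` s].
  apply/seteqP; split=> -[x i] /=; rewrite ms; first by move=> [-> ->].
  by move=> /andP[].
have -> : \sum_(x <- r) A x = size s.
  rewrite size_allpairs_dep sumnE big_map; apply: eq_bigr => x _.
  by rewrite size_iota.
have -> : [set` s] = [set` [fset p | p in s]%fset].
  by apply/seteqP; split=> p /=; rewrite inE.
apply/(@card_eq_fsetP ({classic X} * nat)%type).
by rewrite card_imfset //= undup_id.
Qed.

Lemma sums_to_card D A n : sums_to D A n <-> instances D A #= `I_n.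
Proof.
have cardD : finite_set (D `&` elements A) ->
    exists2 m, sums_to D A m & instances D A #= `I_m.
  move=> /finite_uniq_seq[r ur Dr]; exists (\sum_(x <- r) A x).
    apply/(sums_to_seq _ ur); first by rewrite Dr.
    rewrite -big_filter; congr bigop; apply/all_filterP/allP => x xr.
    by rewrite inE; have : [set` r] x by []; rewrite -Dr => -[].
  rewrite -[X in X #= _](_ : [set p : X * nat | p.1 \in r /\ p.2 < A p.1] = _).
    exact: instances_seq.
  apply/seteqP; split=> -[x i] /= [xD iA].
    by split=> //; have : [set` r] x by []; rewrite -Dr => -[].
  have : (D `&` elements A) x by split=> //; apply: leq_trans iA.
  by rewrite Dr; split.
split=> [sn|cn].
  by have [m sm] := cardD sn.1; rewrite (sums_to_inj sn sm).
(* The support is the first projection of the instances, hence finite as soon as they are. *)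
have [|m sm cm] := cardD.
  have -> : D `&` elements A = fst @` instances D A.
    apply/seteqP; split=> [x [Dx Ax]|_ [[x i] [/= Dx iA] <-]].
      by exists (x, 0).
    by split=> //; apply: leq_trans iA.
  by apply: finite_image; exists n.
suff -> : n = m by [].
by apply/card_eq_II; apply: card_eq_trans cm; rewrite card_eq_sym.
Qed.

Lemma sums_to_ext D D' A n :
  (forall x, 0 < A x -> (D x <-> D' x)) -> sums_to D A n -> sums_to D' A n.
Proof.
move=> DD'; rewrite !sums_to_card; congr (is_true (_ #= _)).
by apply/seteqP; split=> -[x i] /= [Dx iA]; split=> //; apply/DD' => //;
  apply: leq_trans iA.
Qed.

Lemma finite_common_seq D A B : finite_set (D `&` elements A) ->
  finite_set (D `&` elements B) ->
  exists2 r : seq {classic X}, uniq r &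
    D `&` elements A `<=` [set` r] /\ D `&` elements B `<=` [set` r].
Proof.
move=> fA fB.
have [|r ur Dr] := @finite_uniq_seq (D `&` elements A `|` D `&` elements B).
  by rewrite finite_setU.
by exists r => //; rewrite -Dr; split; [exact: subsetUl|exact: subsetUr].
Qed.

Lemma sums_toD D A B m n : sums_to D A m -> sums_to D B n ->
  sums_to D (fun x => A x + B x) (m + n).
Proof.
move=> sA sB; have [r ur [rA rB]] := finite_common_seq sA.1 sB.1.
have rAB : D `&` elements (fun x => A x + B x) `<=` [set` r].
  move=> x [Dx]; rewrite /elements/= addn_gt0 => /orP[Ax|Bx].
    exact: rA.
  exact: rB.
apply/(sums_to_seq _ ur rAB); rewrite big_split /=.
by move/(sums_to_seq _ ur rA): sA => ->; move/(sums_to_seq _ ur rB): sB => ->.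
Qed.

Lemma sums_to_le D A B n : msub A B -> sums_to D B n ->
  exists2 m, sums_to D A m & m <= n.
Proof.
move=> AB sB.
have ABel : D `&` elements A `<=` D `&` elements B.
  by move=> x [Dx Ax]; split=> //; apply: leq_trans (AB x).
have [r ur rB] := finite_uniq_seq sB.1.
have rA : D `&` elements A `<=` [set` r] by rewrite -rB.
exists (\sum_(x <- r | x \in (D : set {classic X})) A x).
  exact/(sums_to_seq _ ur rA).
have /(sums_to_seq _ ur) <- := sB; last by rewrite rB.
by apply: leq_sum => x _; apply: AB.
Qed.

Lemma sums_toB D A B m n : msub B A -> sums_to D A m -> sums_to D B n ->
  sums_to D (fun x => A x - B x) (m - n).
Proof.
move=> BA sA sB.
have [|k sAB km] := @sums_to_le D (fun x => A x - B x) A m _ sA.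
  by move=> x; exact: leq_subr.
suff -> : m - n = k by [].
have := sums_toD sAB sB; rewrite (_ : (fun x => _ + B x) = A).
  by move=> /(sums_to_inj sA) ->; rewrite addnK.
by apply/funext => x; rewrite subnK.
Qed.

Lemma sums_to_ge D A n x : sums_to D A n -> D x -> A x <= n.
Proof.
move=> sA Dx; case: (posnP (A x)) => [->//|Ax].
have [r ur rA] := finite_uniq_seq sA.1.
have /(sums_to_seq _ ur) <- := sA; last by rewrite rA.
have xr : [set` r] x by rewrite -rA.
by rewrite big_mkcond (big_rem _ xr) /= ifT ?leq_addr // inE.
Qed.

(** Splitting off the entry at [y] leaves a sum that still contains [A x]. This yields the
    uniqueness of pre- and post-transitions: two distinct ones would push the sum to 2. *)
Lemma sums_to_ge2 D A n x y : sums_to D A n -> D x -> D y -> x <> y ->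
  A x + A y <= n.
Proof.
move=> sA Dx Dy xy.
pose Ay z := if `[< z = y >] then A z else 0.
have AyA : msub Ay A by move=> z; rewrite /Ay; case: ifP.
have [k sk kn] := sums_to_le AyA sA.
have := sums_toB AyA sA sk.
move=> /(@sums_to_ge _ _ _ x)/(_ Dx); rewrite /Ay asboolF // subn0 => Axn.
have := sums_to_ge sk Dy; rewrite /Ay asboolT // => Ayk.
by rewrite -(subnK kn) leq_add.
Qed.

Lemma sums_to_single D A x : D x ->
  (forall y, D y -> 0 < A y -> y = x) -> sums_to D A (A x).
Proof.
move=> Dx Dy; apply/(@sums_to_seq _ _ [:: x : {classic X}]) => //.
  by move=> y [/Dy h /h ->] /=; rewrite inE.
by rewrite big_cons big_nil ifT ?addn0 // inE.
Qed.

Lemma sums_to0 D A : (forall x, D x -> A x = 0) -> sums_to D A 0.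
Proof.
move=> D0; apply/(@sums_to_seq _ _ [::]) => //; last by rewrite big_nil.
by move=> x [/D0]; rewrite /elements/= => ->.
Qed.

End Sums.

(** * Summation over fibres and lifting of markings along a linking *)

(** Sending an instance of [x] to [h x] and its rank in the fibre is injective, and its image is a
    copy of the instances of [K]. Since cardinalities are compared, the existence of either sum
    gives that of the other. *)
Lemma sums_to_fibres (X Y : Type) (h : X -> option Y) (D : set X)
    (H : multiset X) (K : multiset Y) n :
  (forall x, D x -> 0 < H x -> h x <> None) ->
  (forall y, sums_to [set x | D x /\ h x = Some y] H (K y)) ->
  sums_to D H n <-> sums_to setT K n.
Proof.
move=> hN hK.
have /choice[phi phib] y : exists phi : X * nat -> nat,
    set_bij (instances [set x | D x /\ h x = Some y] H) `I_(K y) phi.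
  by apply/card_set_bijP/sums_to_card.
rewrite !sums_to_card.
pose F p := (h p.1, if h p.1 is Some y then phi y p else 0).
pose G (q : Y * nat) := (Some q.1, q.2).
have FG : F @` instances D H = G @` instances setT K.
  apply/seteqP; split=> [_ [[x i] [/= Dx iH] <-]|_ [[y j] [/= _ jK] <-]].
    case hx: (h x) => [y|]; last by case: (hN x Dx); first exact: leq_trans iH.
    have [phiI _ _] := phib y; exists (y, phi y (x, i)); last by rewrite /F/= hx.
    by split=> //; apply: phiI.
  have [_ _ phiS] := phib y.
  have [[x i] [/= [Dx hx] iH] phij] := phiS j jK.
  by exists (x, i); rewrite /F/= ?hx ?phij.
have Fi : {in instances D H &, injective F}.
  move=> [x i] [x' i']; rewrite !inE => -[/= Dx iH] [/= Dx' iH'].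
  rewrite /F/=; case hx: (h x) => [y|]; last first.
    by case: (hN x Dx); first exact: leq_trans iH.
  move=> [hx']; rewrite -hx' => e; have [_ phii _] := phib y.
  by apply: phii; rewrite // inE.
have Gi : {in instances setT K &, injective G} by move=> [y i] [y' i'] _ _ [-> ->].
rewrite -(card_eql (inj_card_eq Fi)) FG (card_eql (inj_card_eq Gi)).
by [].
Qed.

(** The fibre of [f] over [y1] and the row [y1] of [l] both have [K y1] instances; enumerating both
    by the same initial segment matches them, and [g x] is the second component of the pair matched
    with [x]. Elements outside [H] may have no partner, so [g] is partial. *)
Lemma lift_marking (X Y1 Y2 : Type) (f : X -> Y1) (H : multiset X)
    (l : Y1 * Y2 -> nat) (K : multiset Y1) :
  (forall x, H x <= 1) -> mimage f H K ->
  (forall y1, sums_to setT (fun y2 => l (y1, y2)) (K y1)) ->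
  exists g : X -> option Y2,
    (forall x, 0 < H x -> g x <> None) /\
    forall y1 y2, sums_to [set x | f x = y1 /\ g x = Some y2] H (l (y1, y2)).
Proof.
move=> H1 fH lK.
have /choice[a ab] y : exists a : X * nat -> nat,
    set_bij (instances (f @^-1` [set y]) H) `I_(K y) a.
  by apply/card_set_bijP/sums_to_card.
have /choice[b bb] y : exists b : Y2 * nat -> nat,
    set_bij (instances setT (fun y2 => l (y, y2))) `I_(K y) b.
  by apply/card_set_bijP/sums_to_card.
(* As [H] has multiplicities at most 1, the only instance of an element [x] of [H] is [(x, 0)]. *)
pose R x y2 := exists2 i, i < l (f x, y2) & b (f x) (y2, i) = a (f x) (x, 0).
have /choice[g gR] x :
    exists o, if o is Some y2 then R x y2 else ~ exists y2, R x y2.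
  have [[y2 xy2]|nR] := pselect (exists y2, R x y2); first by exists (Some y2).
  by exists None.
have ex x : 0 < H x -> exists y2, R x y2.
  move=> Hx; have [_ _ bS] := bb (f x); have [aI _ _] := ab (f x).
  have [|[y2 i] [_ /= iy] e] := bS (a (f x) (x, 0)); first exact: aI.
  by exists y2, i.
have gE x y2 : 0 < H x -> (g x = Some y2 <-> R x y2).
  move=> Hx; have := gR x; case: (g x) => [y|]; last by move=> /(_ (ex x Hx)).
  move=> [i iy ei]; split=> [[<-]|[j jy ej]]; first by exists i.
  have [_ bi _] := bb (f x); suff [-> //] : (y, i) = (y2, j).
  by apply: bi; rewrite ?inE ?ei.
exists g; split=> [x Hx gN|y1 y2].
  by have := gR x; rewrite gN; apply; exact: ex.
pose W := instances [set x | f x = y1 /\ g x = Some y2] H.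
pose L := [set y2] `*` `I_(l (y1, y2)).
have [aI ai _] := ab y1; have [bI bi bS] := bb y1.
have Wsub : W `<=` instances (f @^-1` [set y1]) H by move=> [x i] [[/= ? _] ?].
have Lsub : L `<=` instances setT (fun y2 => l (y1, y2)) by move=> [y i] [/= -> ?].
have H0 x i : i < H x -> 0 < H x /\ i = 0.
  move=> iH; split; first exact: leq_trans iH.
  by have := leq_trans iH (H1 x); case: i iH.
(* The instances sent to [y2] and the copies of [y2] in the row have the same numbers, hence equal
   cardinality. *)
have ab_img : a y1 @` W = b y1 @` L.
  apply/seteqP; split=> [_ [[x i] [/= [fx gx] iH] <-]|_ [[y i] [/= -> iy] <-]].
    have [Hx ->] := H0 x i iH; have /gE := gx => /(_ Hx)[j]; rewrite fx => jl <-.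
    by exists (y2, j).
  have : (b y1 (y2, i)) \in `I_(K y1) by rewrite inE; apply: bI; split.
  have [_ _ aS] := ab y1; rewrite inE => /aS[[x j] [/= fx jH] e].
  have [Hx j0] := H0 x j jH; exists (x, j) => //; split=> //; split=> //.
  by apply/gE => //; exists i; rewrite fx // -e j0.
apply/sums_to_card; rewrite -/W.
rewrite -(card_eql (@inj_card_eq _ _ W (a y1) _)); last first.
  by move=> p q; rewrite !inE => /Wsub Wp /Wsub Wq; apply: ai; rewrite inE.
rewrite ab_img (card_eql (@inj_card_eq _ _ L (b y1) _)); last first.
  by move=> p q; rewrite !inE => /Lsub Wp /Lsub Wq; apply: bi; rewrite inE.
have -> : L = (pair y2) @` `I_(l (y1, y2)).
  by apply/seteqP; split=> [[y i] [/= -> ?]|_ [i ? <-]] //; exists i.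
by apply: inj_card_eq => i j _ _ [].
Qed.

(** * Cuts and runs of a causal net *)

Section CausalCuts.
Variables (Act : Type) (C : petri_net Act).
Hypothesis cC : causal_net C.
Implicit Types (D : set (transition C)) (t : transition C) (s : place C).

Definition produced D s := 0 < init C s \/ exists2 t, D t & 0 < post t s.
Definition consumed D s := exists2 t, D t & 0 < pre t s.
(** Stands for the marking after firing each transition of [D] once, described without an order of
    firing. *)
Definition cut D : multiset (place C) :=
  fun s => `[< produced D s /\ ~ consumed D s >].
Definition past_closed D := forall t, D t -> forall s, 0 < pre t s -> produced D s.
Definition ready D t := ~ D t /\ forall s, 0 < pre t s -> produced D s.

Lemma pre_le1 t s : pre t s <= 1.
Proof.
have [_ /(_ s)[_ [n sn n1]] _ _ _] := cC.
exact: leq_trans (sums_to_ge sn (x := t) I) n1.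
Qed.

Lemma post_le1 t s : post t s <= 1.
Proof.
have [_ /(_ s)[[n sn n1] _] _ _ _] := cC.
exact: leq_trans (sums_to_ge sn (x := t) I) n1.
Qed.

Lemma pre_inj t u s : 0 < pre t s -> 0 < pre u s -> t = u.
Proof.
have [_ /(_ s)[_ [n sn n1]] _ _ _] := cC.
move=> ts us; apply: contrapT => tu.
have := leq_trans (sums_to_ge2 sn (x := t) (y := u) I I tu) n1.
by apply/negP; rewrite -ltnNge (leq_add ts us).
Qed.

Lemma post_inj t u s : 0 < post t s -> 0 < post u s -> t = u.
Proof.
have [_ /(_ s)[[n sn n1] _] _ _ _] := cC.
move=> ts us; apply: contrapT => tu.
have := leq_trans (sums_to_ge2 sn (x := t) (y := u) I I tu) n1.
by apply/negP; rewrite -ltnNge (leq_add ts us).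
Qed.

Lemma init_causal s : init C s = ~~ `[< exists t, 0 < post t s >].
Proof. by have [_ _ /(_ s) -> _ _] := cC; case: ifP. Qed.

Lemma init_le1 s : init C s <= 1.
Proof. by rewrite init_causal; case: (~~ _). Qed.

Lemma init_post t s : 0 < init C s -> 0 < post t s -> False.
Proof. by rewrite init_causal lt0b => /asboolPn + ts; apply; exists t. Qed.

Lemma pre_post t s : 0 < pre t s -> 0 < post t s -> False.
Proof.
move=> pts qts; have [_ _ _ /(_ (inr t)) + _] := cC; apply.
by apply: (@t_trans _ _ _ (inl s)); apply: t_step.
Qed.

Lemma produced_mono D D' : D `<=` D' -> produced D `<=` produced D'.
Proof. by move=> DD' s [|[t /DD']]; [left|right; exists t]. Qed.

Lemma produced_fresh D t s : ~ D t -> 0 < post t s -> ~ produced D s.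
Proof.
move=> Dt ts [/init_post/(_ ts)//|[u Du us]].
by apply: Dt; rewrite (post_inj ts us).
Qed.

(** Only [t] itself could have consumed a token from its preset, because a place has at most one
    post-transition. *)
Lemma ready_cut D t : ready D t -> msub (pre t) (cut D).
Proof.
move=> [Dt tD] s; have := pre_le1 t s; case: (posnP (pre t s)) => [->//|ts].
move=> /leq_trans; apply; rewrite lt0b; apply/asboolP; split; first exact: tD.
by move=> [u Du us]; apply: Dt; rewrite (pre_inj ts us).
Qed.

(** The places split into outputs of [t], inputs of [t] and the others; by acyclicity no place is
    both input and output. *)
Lemma cut_fire D t : past_closed D -> ready D t ->
  cut (t |` D) = fire (cut D) t.
Proof.
move=> cD rt; apply/funext => s; have [Dt tD] := rt; rewrite /fire.
case: (posnP (post t s)) => [ts0|ts]; last first.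
  have -> : pre t s = 0.
    by apply/eqP; rewrite -leqn0 leqNgt; apply/negP => /pre_post; apply.
  have -> : post t s = 1 by apply/eqP; rewrite eqn_leq post_le1.
  have nD := produced_fresh Dt ts.
  rewrite /cut asboolT; last first.
    split; first by right; exists t => //; left.
    move=> [u [->|Du] us]; first exact: pre_post us ts.
    (* A consumer of [s] in the past-closed [D] would make [s] produced by [D], but outputs of the
       unfired [t] are not. *)
    exact/nD/(cD u).
  by rewrite asboolF // => -[].
rewrite ts0 addn0; case: (posnP (pre t s)) => [pts0|pts].
  rewrite pts0 subn0 /cut; congr (nat_of_bool (asbool _)); apply/propext.
  split=> -[p c]; split.
  - case: p => [|[u [->|Du us]]]; [by left|by rewrite ts0|by right; exists u].
  - by move=> [u Du us]; apply: c; exists u => //; right.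
  - by apply: produced_mono p => u; right.
  - by move=> [u [->|Du]]; rewrite ?pts0 // => us; apply: c; exists u.
have -> : pre t s = 1 by apply/eqP; rewrite eqn_leq pre_le1.
have /eqP -> : cut D s - 1 == 0 by rewrite subn_eq0; exact: leq_b1.
rewrite /cut asboolF //.
by move=> [_]; apply; exists t => //; left.
Qed.

Lemma past_closedU D t : past_closed D -> ready D t -> past_closed (t |` D).
Proof.
by move=> cD [_ tD] u [->|Du] s us; apply: (@produced_mono D) => [v|];
  [right|exact: tD|right|exact: cD us].
Qed.

(* The ready transitions have disjoint presets, so they are concurrently enabled
   at the cut. *)
Lemma ready_finite D : reachable (cut D) -> finite_set (ready D).
Proof.
move=> rD; apply: contrapT => infD; have [bC _ _ _ _] := cC; apply: bC.
pose U : multiset (transition C) := fun t => `[< ready D t >].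
exists (cut D), U; split => //.
  rewrite (_ : elements U = ready D) //.
  by apply/seteqP; split=> t; rewrite /elements /U /= lt0b => /asboolP.
move=> s; pose W t := U t * pre t s.
have [[t Wt]|W0] := pselect (exists t, 0 < W t); last first.
  exists 0 => //; apply: sums_to0 => t _; apply/eqP; rewrite -leqn0 leqNgt.
  by apply/negP => Wt; apply: W0; exists t.
move: (Wt); rewrite muln_gt0 lt0b => /andP[/asboolP rt ts].
(* Post-transitions being unique, [t] is the only contribution to the sum at [s]. *)
exists (W t).
  apply: sums_to_single => // u _; rewrite muln_gt0 => /andP[_ us].
  exact: pre_inj us ts.
by rewrite /W /U asboolT // mul1n; apply: ready_cut.
Qed.

(** An input place of [t] is initial or has a pre-transition, which is then a causal predecessor of
    [t]. *)
Lemma ready_producers D t :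
  ~ D t -> (forall u, flow_plus (inr u) (inr t) -> D u) -> ready D t.
Proof.
move=> Dt pD; split=> // s ts.
case: (posnP (init C s)) => [s0|]; last by left.
right; move: s0; rewrite init_causal => /eqP; rewrite eqb0 negbK => /asboolP[u us].
exists u => //; apply: pD; apply: (@t_trans _ _ _ (inl s)); exact: t_step.
Qed.

(* Induction on the cardinality of the past of t. *)
Lemma staged_run_exhausts (D : nat -> set (transition C)) :
  (forall n, D n `<=` D n.+1) -> (forall n, ready (D n) `<=` D n.+1) ->
  forall t, exists n, D n t.
Proof.
move=> Dn rD; have Dm m n : m <= n -> D m `<=` D n.
  elim: n => [|n IH]; first by rewrite leqn0 => /eqP ->.
  by rewrite leq_eqVlt => /predU1P[->//|/IH mn]; exact: subset_trans (Dn n).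
pose past t : set {classic transition C} := [set u | flow_plus (inr u) (inr t)].
have pastF t : finite_set (past t) by have [_ _ _ _] := cC; apply.
have past_irr t : ~ past t t by have [_ _ _ + _] := cC; apply.
have pastS u t : past t u -> past u `<=` past t.
  by move=> tu v uv; apply: t_trans tu.
move=> t; have [k] := ubnP (#|` fset_set (past t)|).
elim: k t => // k IH t tk.
(* The past of a predecessor [u] is strictly smaller: it omits [u] itself. *)
have ex u : past t u -> exists n, D n u.
  move=> tu; apply: IH; move: tk; rewrite ltnS; apply: leq_trans.
  apply: fproper_ltn_card; rewrite fproperE; apply/andP; split.
    by rewrite -fset_set_sub //; apply: pastS.
  by apply/negP; rewrite -fset_set_sub // => /(_ u tu); apply: past_irr.
have [n nP] : exists n, past t `<=` D n.
  have /choice[N NP] u : exists n, past t u -> D n u.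
    by have [/ex[n]|] := pselect (past t u); [exists n|exists 0].
  (* By finiteness of the past, some stage contains all predecessors; [t] fires at the next one at
     the latest. *)
  exists (\max_(u <- fset_set (past t)) N u) => u tu.
  apply: Dm (NP u tu); apply: leq_bigmax_seq => //.
  by rewrite in_fset_set // inE.
have [Dt|Dt] := pselect (D n t); first by exists n.
by exists n.+1; apply: rD; apply: ready_producers.
Qed.

End CausalCuts.

(** * Images of multisets under partial maps and pairs of maps *)

Definition partial_image (X Y : Type) (g : X -> option Y) (H : multiset X)
    (K : multiset Y) : Prop :=
  forall y, sums_to [set x | g x = Some y] H (K y).

Definition pair_image (X Y1 Y2 : Type) (f : X -> Y1) (g : X -> option Y2)
    (H : multiset X) (l : multiset (Y1 * Y2)) : Prop :=
  forall y1 y2, sums_to [set x | f x = y1 /\ g x = Some y2] H (l (y1, y2)).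

Lemma partial_image_ext (X Y : Type) (g g' : X -> option Y) H K :
  (forall x, 0 < H x -> g' x = g x) -> partial_image g H K -> partial_image g' H K.
Proof. by move=> gg' gK y; apply: sums_to_ext (gK y) => x /gg' /= ->. Qed.

Lemma pair_image_ext (X Y1 Y2 : Type) (f : X -> Y1) (g g' : X -> option Y2) H l :
  (forall x, 0 < H x -> g' x = g x) -> pair_image f g H l -> pair_image f g' H l.
Proof. by move=> gg' gl y1 y2; apply: sums_to_ext (gl y1 y2) => x /gg' /= ->. Qed.

Section PairImage.
Variables (X Y1 Y2 : Type) (f : X -> Y1) (g : X -> option Y2) (H : multiset X).

(** The fibre of [f] over [y1] is partitioned by the values of [g], which is defined throughout
    [H]. *)
Lemma pair_image_fst l K : (forall x, 0 < H x -> g x <> None) ->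
  pair_image f g H l -> mimage f H K ->
  forall y1, sums_to setT (fun y2 => l (y1, y2)) (K y1).
Proof.
move=> gN gl fK y1.
have gN' x : (f @^-1` [set y1]) x -> 0 < H x -> g x <> None.
  by move=> _; apply: gN.
by apply/(sums_to_fibres (K y1) gN' (gl y1)); apply: fK.
Qed.

Lemma pair_image_snd l K : pair_image f g H l ->
  (forall y2, sums_to setT (fun y1 => l (y1, y2)) (K y2)) -> partial_image g H K.
Proof.
move=> gl lK y2.
(* Here the fibre of [g] is partitioned by the total map [f]. *)
apply/(@sums_to_fibres _ _ (Some \o f) _ _ (fun y1 => l (y1, y2))) => // y1.
by apply: sums_to_ext (gl y1 y2) => x _ /=; split=> [[-> ->]|[-> [->]]].
Qed.

End PairImage.

(** * Transferring a folding along the bisimulation *)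

Section Simulation.
Variables (Act : Type) (C N1 N2 : petri_net Act).
Variables (B : set (linking N1 N2)).
Variables (rhoS : place C -> place N1) (rhoT : transition C -> transition N1).
Hypotheses (cC : causal_net C) (simB : sp_bisimulation B).
Hypothesis foldC : folding rhoS rhoT.

(* No map on transitions is recorded: the images of the fired transitions in N2
   can be chosen independently at the end. *)
Record partial_folding (D : set (transition C)) (g : place C -> option (place N2)) :
    Prop := PartialFolding {
  pf_closed : past_closed D;
  pf_reachable : reachable (cut D);
  pf_produced : forall s, produced D s -> g s <> None;
  pf_linked : exists2 l, B l & pair_image rhoS g (cut D) l;
  pf_init : partial_image g (init C) (init N2);
  pf_fired : forall t, D t -> exists t2 : transition N2,
    [/\ label t = label t2, partial_image g (pre t) (pre t2) &
        partial_image g (post t) (post t2)] }.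

(** Only values on places already produced are frozen; the others may still be redefined. *)
Definition extends (D : set (transition C)) (g : place C -> option (place N2))
    D' g' :=
  D `<=` D' /\ forall s, produced D s -> g' s = g s.

Lemma extends_refl D g : extends D g D g.
Proof. by split. Qed.

Lemma extends_trans D g D' g' D'' g'' :
  extends D g D' g' -> extends D' g' D'' g'' -> extends D g D'' g''.
Proof.
move=> [DD' gg'] [D'D'' g'g'']; split; first exact: subset_trans D'D''.
by move=> s Ds; rewrite g'g'' ?gg' //; apply: produced_mono Ds.
Qed.

Lemma partial_folding0 l : B l -> proj1_link l (init N1) ->
  proj2_link l (init N2) -> exists g, partial_folding set0 g.
Proof.
move=> Bl l1 l2; have [_ _ fi _ _] := foldC.
have [g [gN gl]] := lift_marking (init_le1 cC) fi l1.
have cut0 : cut set0 = init C.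
  apply/funext => s; rewrite /cut; have := init_le1 cC s.
  case: (posnP (init C s)) => s0 s1.
    by rewrite asboolF ?s0 // => -[[|[]]] //; rewrite s0.
  rewrite asboolT; last by split; [left|move=> []].
  by apply/eqP; rewrite eqn_leq s0 s1.
exists g; split => //.
- by rewrite cut0; apply: reachable_init.
- by move=> s [|[]]; [exact: gN|].
- by exists l; rewrite ?cut0.
- exact: pair_image_snd gl l2.
Qed.

Lemma fire_ready D g t : partial_folding D g -> ready D t ->
  exists D' g', [/\ partial_folding D' g', extends D g D' g' & D' t].
Proof.
move=> pf rt; have [cD rD gD [l Bl gl] gi gf] := pf.
have [_ labC _ preC postC] := foldC.
have ct := ready_cut cC rt.
(* [c] counts the input places of [t] lying over each pair; it is below [l] because the preset lies
   in the cut. *)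
have /choice[c cP] p : exists n,
    sums_to [set s | rhoS s = p.1 /\ g s = Some p.2] (pre t) n /\ n <= l p.
  by case: p => s1 s2; have [n sn nl] := sums_to_le ct (gl s1 s2); exists n.
have gc : pair_image rhoS g (pre t) c by move=> s1 s2; have [] := cP (s1, s2).
have cl : msub c l by move=> p; have [] := cP p.
have gpre s : 0 < pre t s -> g s <> None by move=> ts; apply: gD; apply: rt.2.
have [/(_ (rhoT t) (pair_image_fst gpre gc (preC t)))] := simB Bl cl.
move=> [t2 [c' [lab2 c2 c'1 c'2 Bl']]] _.
have [h [hN hc']] := lift_marking (post_le1 cC t) (postC t) c'1.
pose g' s := if `[< 0 < post t s >] then h s else g s.
have g'h s : 0 < post t s -> g' s = h s by move=> ts; rewrite /g' asboolT.
have g'g s : ~ 0 < post t s -> g' s = g s by move=> ts; rewrite /g' asboolF.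
have g'D s : produced D s -> g' s = g s.
  by move=> Ds; apply: g'g => ts; exact: (produced_fresh cC rt.1 ts).
have g'pre s : 0 < pre t s -> g' s = g s by move=> ts; apply: g'D; apply: rt.2.
have g'cut s : 0 < cut D s -> g' s = g s.
  by rewrite lt0b => /asboolP[Ds _]; apply: g'D.
have gl' := pair_image_ext g'cut gl.
have gc' := pair_image_ext g'pre gc.
have hc := pair_image_ext g'h hc'.
exists (t |` D), g'; split; last by left.
- split.
  + exact: past_closedU.
  + by rewrite cut_fire //; apply: reachable_fire.
  + move=> s; have [ts|ts] := pselect (0 < post t s).
      by rewrite g'h // => _; apply: hN.
    rewrite g'g // => -[si|[u [->|Du] us]]; [|by case: ts|].
      by apply: gD; left.
    by apply: gD; right; exists u.
  (* [fire] and [replace_link] have the same shape, and the preset lies below the cut, so the counts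
     subtract and add accordingly. *)
  + exists (replace_link l c c') => // s1 s2; rewrite cut_fire //.
    apply: sums_toD; last exact: hc.
    exact: sums_toB ct (gl' s1 s2) (gc' s1 s2).
  + by apply: partial_image_ext gi => s si; apply: g'D; left.
  + move=> u [->|Du].
      exists t2; split; first by rewrite lab2.
        exact: pair_image_snd gc' c2.
      exact: pair_image_snd hc c'2.
    have [u2 [lu pu qu]] := gf u Du; exists u2; split => //.
      by apply: partial_image_ext pu => s us; apply: g'D; apply: cD us.
    by apply: partial_image_ext qu => s us; apply: g'D; right; exists u.
- by split=> // u Du; right.
Qed.

Lemma fire_all_ready D g : partial_folding D g ->
  exists D' g', [/\ partial_folding D' g', extends D g D' g' & ready D `<=` D'].
Proof.
move=> pf; have [r _ rE] := finite_uniq_seq (ready_finite cC (pf_reachable pf)).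
suff [D' [g' [pf' ext rD']]] : exists D' g', [/\ partial_folding D' g',
    extends D g D' g' & [set` r] `<=` D'].
  by exists D', g'; split; rewrite ?rE.
have : [set` r] `<=` ready D by rewrite rE.
elim: {rE}r => [_|t r IH rD]; first by exists D, g; split=> //; exact: extends_refl.
have [|D1 [g1 [pf1 ext1 rD1]]] := IH.
  by move=> u /= ur; apply: rD; rewrite /= inE ur orbT.
(* The inductive extension may already contain [t]; otherwise [t] is still ready, since produced
   places stay produced. *)
have [D1t|D1t] := pselect (D1 t).
  by exists D1, g1; split=> // u /=; rewrite inE => /predU1P[->//|/rD1].
have rt1 : ready D1 t.
  split=> // s ts; apply: (produced_mono ext1.1); have := rD t; rewrite /= inE eqxx.
  by move=> /(_ isT) [_]; apply.
have [D2 [g2 [pf2 ext2 D2t]]] := fire_ready pf1 rt1.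
exists D2, g2; split=> //; first exact: extends_trans ext2.
move=> u /=; rewrite inE => /predU1P[->//|/rD1]; exact: ext2.1.
Qed.

(** The partial foldings along the staged run have a limit: the image of a place is its value at any
    stage where it is produced. *)
Lemma folding_transfer l : B l -> proj1_link l (init N1) ->
  proj2_link l (init N2) -> type_of_net N1 = type_of_net N2 ->
  exists (rhoS2 : place C -> place N2) (rhoT2 : transition C -> transition N2),
    folding rhoS2 rhoT2.
Proof.
move=> Bl l1 l2 N12; have [tyC _ _ _ _] := foldC.
have [g0 pf0] := partial_folding0 Bl l1 l2.
(* Packing the invariant into the states lets choice give a step function that can be iterated. *)
pose state := {st : set (transition C) * (place C -> option (place N2)) |
  partial_folding st.1 st.2}.
have /choice[next nextP] (st : state) : exists st' : state,
    extends (sval st).1 (sval st).2 (sval st').1 (sval st').2 /\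
    ready (sval st).1 `<=` (sval st').1.
  case: st => -[D g] /= /fire_all_ready[D' [g' [pf' ext rD]]].
  by exists (exist _ (D', g') pf').
pose st n : state := iter n next (exist _ (set0, g0) pf0).
pose D n := (sval (st n)).1; pose g n := (sval (st n)).2.
have pf n : partial_folding (D n) (g n) := svalP (st n).
have ext m n : m <= n -> extends (D m) (g m) (D n) (g n).
  elim: n => [|n IH]; first by rewrite leqn0 => /eqP ->; apply: extends_refl.
  rewrite leq_eqVlt => /predU1P[->|/IH mn]; first exact: extends_refl.
  exact: extends_trans mn (nextP (st n)).1.
have allD : forall t, exists n, D n t.
  apply: staged_run_exhausts => // n; last exact: (nextP (st n)).2.
  exact: (ext n n.+1 (leqnSn n)).1.
(* A place is initial, thus produced at stage 0, or an output of a transition that fires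
   eventually. *)
have /choice[rho rhoP] s : exists y, exists2 n, produced (D n) s & g n s = Some y.
  have [n Ds] : exists n, produced (D n) s.
    case: (posnP (init C s)) => [|si]; last by exists 0; left.
    rewrite (init_causal cC) => /eqP; rewrite eqb0 negbK => /asboolP[t ts].
    by have [n Dt] := allD t; exists n; right; exists t.
  case gs: (g n s) => [y|]; first by exists y, n.
  by case: (pf_produced (pf n) Ds).
(* Of two stages producing [s], the later extends the earlier, so they agree on [s]. *)
have rhoE n s : produced (D n) s -> g n s = Some (rho s).
  move=> Ds; have [m Dms <-] := rhoP s; case: (leqP m n) => [mn|/ltnW nm].
    exact: (ext m n mn).2.
  by rewrite (ext n m nm).2.
have mimageP n H K : (forall s, 0 < H s -> produced (D n) s) ->
    partial_image (g n) H K -> mimage rho H K.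
  move=> HD gK y; apply: sums_to_ext (gK y) => s /HD /rhoE /= ->.
  by split=> [[]|->].
have /choice[rhoT2 rhoT2P] t : exists t2 : transition N2,
    [/\ label t = label t2, mimage rho (pre t) (pre t2) &
        mimage rho (post t) (post t2)].
  have [n Dt] := allD t; have [t2 [lt pt qt]] := pf_fired (pf n) Dt.
  exists t2; split=> //; first by apply: mimageP pt; apply: pf_closed Dt.
  by apply: mimageP qt => s ts; right; exists t.
exists rho, rhoT2; split; first by rewrite tyC.
- by move=> t; have [] := rhoT2P t.
- by apply: (mimageP 0) (pf_init (pf 0)) => s; left.
- by move=> t; have [] := rhoT2P t.
- by move=> t; have [] := rhoT2P t.
Qed.

End Simulation.

(** * Symmetry of sp-bisimilarity and causal equivalence *)

Definition swap_link (Act : Type) (N1 N2 : petri_net Act) (l : linking N1 N2) :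
  linking N2 N1 := fun p => l (p.2, p.1).

Lemma swap_linkK (Act : Type) (N1 N2 : petri_net Act) (l : linking N1 N2) :
  swap_link (swap_link l) = l.
Proof. by apply/funext => -[]. Qed.

Lemma sp_bisimilar_sym (Act : Type) (N1 N2 : petri_net Act) :
  sp_bisimilar N1 N2 -> sp_bisimilar N2 N1.
Proof.
move=> [tyN [B [simB [l [Bl l1 l2]]]]]; split=> //.
exists [set m | B (swap_link m)]; split; last first.
  by exists (swap_link l); split; rewrite //= swap_linkK.
move=> m c Bm cm; have [|h1 h2] := simB (swap_link m) (swap_link c) Bm.
  by move=> p; apply: cm.
(* Writing [c'] as a double swap exhibits the new linking as the swap of
   [replace_link m c (swap_link c')]. *)
by split=> [t2 /h2|t1 /h1] [t [c' [lt ct c'1 c'2]]]; rewrite -{1}[c']swap_linkK;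
  exists t, (swap_link c').
Qed.

Lemma sp_bisimilar_causal_net_of (Act : Type) (N1 N2 C : petri_net Act) :
  sp_bisimilar N1 N2 -> causal_net_of N1 C -> causal_net_of N2 C.
Proof.
move=> [tyN [B [simB [l [Bl l1 l2]]]]] [rhoS [rhoT [cC fC]]].
have [rhoS2 [rhoT2 fC2]] := folding_transfer cC simB fC Bl l1 l2 tyN.
by exists rhoS2, rhoT2.
Qed.

Theorem theorem4 (Act : Type) (N1 N2 : petri_net Act)
    (net1 : is_net N1) (net2 : is_net N2) :
  sp_bisimilar N1 N2 -> causal_equivalent N1 N2.
Proof.
move=> N12 C; split; apply: sp_bisimilar_causal_net_of => //.
exact: sp_bisimilar_sym.
Qed.
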